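(* Let $B$ be the first-order $\mathcal{L}_{BT}$-theory with the eleven axioms listed in the context, and let $\mathfrak{B}$ be the standard structure of bit strings with concatenation and the substring relation. For any $\Sigma$-sentence $\phi$, we have $$\mathfrak{B} \models \phi \; \Rightarrow \; B \vdash \phi .$$
   Context: $\mathcal{L}_{BT}$ is the first-order language (with equality) consisting of the constant symbols $e,0,1$, the binary function symbol $\circ$ and the binary relation symbol $\sqsubseteq$. One writes $st$ for $s\circ t$, and $s \neq t$ for $\neg s=t$. The $\mathcal{L}_{BT}$-structure $\mathfrak{B}$: its universe is the set $\{\boldsymbol{0},\boldsymbol{1}\}^*$ of all finite bit strings, including the empty string $\varepsilon$; $e^{\mathfrak{B}}=\varepsilon$, $0^{\mathfrak{B}}$ is the one-bit string $\boldsymbol{0}$, $1^{\mathfrak{B}}$ is the one-bit string $\boldsymbol{1}$; $\circ^{\mathfrak{B}}$ is concatenation; and $u \sqsubseteq^{\mathfrak{B}} v$ iff $u$ is a substring of $v$, i.e. iff there exist bit strings $x,y$ with $xuy=v$. Bounded quantifiers: $(\exists x\sqsubseteq t)\alpha$ abbreviates $(\exists x)[x\sqsubseteq t\wedge\alpha]$ and $(\forall x\sqsubseteq t)\alpha$ abbreviates $(\forall x)[x\sqsubseteq t\rightarrow\alpha]$, where the variable $x$ does not occur in the term $t$. The $\Sigma$-formulas are defined inductively: $\alpha$ and $\neg\alpha$ are $\Sigma$-formulas if $\alpha$ is of the form $s\sqsubseteq t$ or $s=t$ for terms $s,t$; $\alpha\vee\beta$ and $\alpha\wedge\beta$ are $\Sigma$-formulas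 if $\alpha,\beta$ are; $(\exists x\sqsubseteq t)\alpha$, $(\forall x\sqsubseteq t)\alpha$ and $(\exists x)\alpha$ are $\Sigma$-formulas if $\alpha$ is. A $\Sigma$-sentence is a $\Sigma$-formula with no free variables. The first-order theory $B$ has the following non-logical axioms: 1. $\forall x[x=ex\wedge x=xe]$; 2. $\forall x y z[(xy)z=x(yz)]$; 3. $\forall x y[x\neq y\to((x0\neq y0)\wedge(x1\neq y1))]$; 4. $\forall x y[x0\neq y1]$; 5. $\forall x[x\sqsubseteq e\leftrightarrow x=e]$; 6. $\forall x[x\sqsubseteq 0\leftrightarrow(x=e\vee x=0)]$; 7. $\forall x[x\sqsubseteq 1\leftrightarrow(x=e\vee x=1)]$; 8. $\forall x y[x\sqsubseteq 0y0\leftrightarrow(x=0y0\vee x\sqsubseteq 0y\vee x\sqsubseteq y0)]$; 9. $\forall x y[x\sqsubseteq 0y1\leftrightarrow(x=0y1\vee x\sqsubseteq 0y\vee x\sqsubseteq y1)]$; 10. $\forall x y[x\sqsubseteq 1y0\leftrightarrow(x=1y0\vee x\sqsubseteq 1y\vee x\sqsubseteq y0)]$; 11. $\forall x y[x\sqsubseteq 1y1\leftrightarrow(x=1y1\vee x\sqsubseteq 1y\vee x\sqsubseteq y1)]$. $B\vdash\phi$ means that $\phi$ is derivable from the axioms of $B$ in first-order logic with equality. *)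

(* Defs.v *)
(* Written with the Rocq standard library only. *)
From Stdlib Require Import List.
Import ListNotations.

(** * The language L_BT

    Variables are de Bruijn indices: [Var n] refers to the [n]-th enclosing
    quantifier, counted from the inside, and indices that point past all
    enclosing quantifiers are free. *)

Inductive term : Type :=
| Var (n : nat)
| Emp
| Zero
| One
| Cat (s t : term).

Inductive form : Type :=
| Eq (s t : term)
| Sub (s t : term)
| Neg (a : form)
| And (a b : form)
| Or (a b : form)
| Imp (a b : form)
| All (a : form)
| Ex (a : form).

Definition Iff (a b : form) : form := And (Imp a b) (Imp b a).

Declare Scope bt_scope.
Delimit Scope bt_scope with bt.
Bind Scope bt_scope with term.
Bind Scope bt_scope with form.

Notation "s ∘ t" := (Cat s t) (at level 40, left associativity) : bt_scope.
Notation "s ≐ t" := (Eq s t) (at level 70, no associativity) : bt_scope.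
Notation "s ≠ t" := (Neg (Eq s t)) (at level 70, no associativity) : bt_scope.
Notation "s ⊑ t" := (Sub s t) (at level 70, no associativity) : bt_scope.
Notation "a ∧ b" := (And a b) (at level 80, right associativity) : bt_scope.
Notation "a ∨ b" := (Or a b) (at level 85, right associativity) : bt_scope.
Notation "a ⇒ b" := (Imp a b) (at level 90, right associativity) : bt_scope.
Notation "a ⇔ b" := (Iff a b) (at level 95, no associativity) : bt_scope.

(** ** Free variables *)

Fixpoint occurs (k : nat) (t : term) : Prop :=
  match t with
  | Var n => n = k
  | Emp | Zero | One => False
  | Cat s t => occurs k s \/ occurs k t
  end.

Fixpoint free (k : nat) (a : form) : Prop :=
  match a with
  | Eq s t | Sub s t => occurs k s \/ occurs k t
  | Neg a => free k a
  | And a b | Or a b | Imp a b => free k a \/ free k b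
  | All a | Ex a => free (S k) a
  end.

Definition sentence (a : form) : Prop := forall k, ~ free k a.

(** ** Simultaneous substitution *)

Fixpoint tsubst (f : nat -> term) (t : term) : term :=
  match t with
  | Var n => f n
  | Emp => Emp
  | Zero => Zero
  | One => One
  | Cat s t => Cat (tsubst f s) (tsubst f t)
  end.

(** [shift] renumbers the free variables for use under one more quantifier,
    so the variable bound by that quantifier does not occur in [tshift t]. *)
Definition shift (n : nat) : term := Var (S n).
Definition tshift (t : term) : term := tsubst shift t.

Definition up (f : nat -> term) (n : nat) : term :=
  match n with
  | 0 => Var 0
  | S m => tshift (f m)
  end.

Fixpoint fsubst (f : nat -> term) (a : form) : form :=
  match a with
  | Eq s t => Eq (tsubst f s) (tsubst f t)
  | Sub s t => Sub (tsubst f s) (tsubst f t)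
  | Neg a => Neg (fsubst f a)
  | And a b => And (fsubst f a) (fsubst f b)
  | Or a b => Or (fsubst f a) (fsubst f b)
  | Imp a b => Imp (fsubst f a) (fsubst f b)
  | All a => All (fsubst (up f) a)
  | Ex a => Ex (fsubst (up f) a)
  end.

Definition fshift (a : form) : form := fsubst shift a.

(** [inst t a] is the body [a] of a quantifier with its variable replaced by
    [t]; the remaining free variables are renumbered down by one. *)
Definition single (t : term) (n : nat) : term :=
  match n with
  | 0 => t
  | S m => Var m
  end.

Definition inst (t : term) (a : form) : form := fsubst (single t) a.

(** ** Bounded quantifiers and Sigma-formulas *)

(** The bound [t] lives outside the quantifier; shifting it expresses that the
    quantified variable does not occur in it. *)
Definition BEx (t : term) (a : form) : form := Ex (And (Sub (Var 0) (tshift t)) a).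
Definition BAll (t : term) (a : form) : form := All (Imp (Sub (Var 0) (tshift t)) a).

Inductive Sigma : form -> Prop :=
| Sigma_sub s t : Sigma (Sub s t)
| Sigma_nsub s t : Sigma (Neg (Sub s t))
| Sigma_eq s t : Sigma (Eq s t)
| Sigma_neq s t : Sigma (Neg (Eq s t))
| Sigma_or a b : Sigma a -> Sigma b -> Sigma (Or a b)
| Sigma_and a b : Sigma a -> Sigma b -> Sigma (And a b)
| Sigma_bex t a : Sigma a -> Sigma (BEx t a)
| Sigma_ball t a : Sigma a -> Sigma (BAll t a)
| Sigma_ex a : Sigma a -> Sigma (Ex a).

(** * Structures and truth *)

Record structure : Type := Structure {
  carrier :> Type;
  emp : carrier;
  zero : carrier;
  one : carrier;
  cat : carrier -> carrier -> carrier;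
  sub : carrier -> carrier -> Prop
}.

Fixpoint eval (M : structure) (r : nat -> M) (t : term) : M :=
  match t with
  | Var n => r n
  | Emp => emp M
  | Zero => zero M
  | One => one M
  | Cat s t => cat M (eval M r s) (eval M r t)
  end.

Definition extend (M : structure) (d : M) (r : nat -> M) (n : nat) : M :=
  match n with
  | 0 => d
  | S m => r m
  end.

Fixpoint sat (M : structure) (r : nat -> M) (a : form) : Prop :=
  match a with
  | Eq s t => eval M r s = eval M r t
  | Sub s t => sub M (eval M r s) (eval M r t)
  | Neg a => ~ sat M r a
  | And a b => sat M r a /\ sat M r b
  | Or a b => sat M r a \/ sat M r b
  | Imp a b => sat M r a -> sat M r b
  | All a => forall d : M, sat M (extend M d r) a
  | Ex a => exists d : M, sat M (extend M d r) a
  end.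

Definition models (M : structure) (a : form) : Prop := forall r : nat -> M, sat M r a.

Definition substring (u v : list bool) : Prop :=
  exists x y : list bool, x ++ u ++ y = v.

(** The bit 0 is [false] and the bit 1 is [true]. *)
Definition bitstrings : structure :=
  {| carrier := list bool;
     emp := [];
     zero := [false];
     one := [true];
     cat := @app bool;
     sub := substring |}.

(** * Derivability

    Classical natural deduction with equality. In [All_I] and [Ex_E] the
    eigenvariable is index 0; shifting the hypotheses (and the conclusion of
    [Ex_E]) is the eigenvariable condition. *)

Inductive derives : list form -> form -> Prop :=
| Hyp G a : In a G -> derives G a
| Neg_I G a b : derives (a :: G) b -> derives (a :: G) (Neg b) -> derives G (Neg a)
| Neg_Neg_E G a : derives G (Neg (Neg a)) -> derives G a
| And_I G a b : derives G a -> derives G b -> derives G (And a b)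
| And_E1 G a b : derives G (And a b) -> derives G a
| And_E2 G a b : derives G (And a b) -> derives G b
| Or_I1 G a b : derives G a -> derives G (Or a b)
| Or_I2 G a b : derives G b -> derives G (Or a b)
| Or_E G a b c :
    derives G (Or a b) -> derives (a :: G) c -> derives (b :: G) c -> derives G c
| Imp_I G a b : derives (a :: G) b -> derives G (Imp a b)
| Imp_E G a b : derives G (Imp a b) -> derives G a -> derives G b
| All_I G a : derives (map fshift G) a -> derives G (All a)
| All_E G a t : derives G (All a) -> derives G (inst t a)
| Ex_I G a t : derives G (inst t a) -> derives G (Ex a)
| Ex_E G a b :
    derives G (Ex a) -> derives (a :: map fshift G) (fshift b) -> derives G b
| Eq_I G t : derives G (Eq t t)
| Eq_E G a s t : derives G (Eq s t) -> derives G (inst s a) -> derives G (inst t a).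

(** * The theory B

    Under one quantifier x is [Var 0]; under [forall x y], x is [Var 1] and y
    is [Var 0]; under [forall x y z], x, y, z are [Var 2], [Var 1], [Var 0].
    Iterated concatenations such as 0y0 are read as associating to the left. *)

Definition B : list form := [
  All (Var 0 ≐ Emp ∘ Var 0 ∧ Var 0 ≐ Var 0 ∘ Emp);
  All (All (All ((Var 2 ∘ Var 1) ∘ Var 0 ≐ Var 2 ∘ (Var 1 ∘ Var 0))));
  All (All (Var 1 ≠ Var 0 ⇒
    (Var 1 ∘ Zero ≠ Var 0 ∘ Zero) ∧ (Var 1 ∘ One ≠ Var 0 ∘ One)));
  All (All (Var 1 ∘ Zero ≠ Var 0 ∘ One));
  All (Var 0 ⊑ Emp ⇔ Var 0 ≐ Emp);
  All (Var 0 ⊑ Zero ⇔ Var 0 ≐ Emp ∨ Var 0 ≐ Zero);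
  All (Var 0 ⊑ One ⇔ Var 0 ≐ Emp ∨ Var 0 ≐ One);
  All (All (Var 1 ⊑ Zero ∘ Var 0 ∘ Zero ⇔
    Var 1 ≐ Zero ∘ Var 0 ∘ Zero ∨ Var 1 ⊑ Zero ∘ Var 0 ∨ Var 1 ⊑ Var 0 ∘ Zero));
  All (All (Var 1 ⊑ Zero ∘ Var 0 ∘ One ⇔
    Var 1 ≐ Zero ∘ Var 0 ∘ One ∨ Var 1 ⊑ Zero ∘ Var 0 ∨ Var 1 ⊑ Var 0 ∘ One));
  All (All (Var 1 ⊑ One ∘ Var 0 ∘ Zero ⇔
    Var 1 ≐ One ∘ Var 0 ∘ Zero ∨ Var 1 ⊑ One ∘ Var 0 ∨ Var 1 ⊑ Var 0 ∘ Zero));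
  All (All (Var 1 ⊑ One ∘ Var 0 ∘ One ⇔
    Var 1 ≐ One ∘ Var 0 ∘ One ∨ Var 1 ⊑ One ∘ Var 0 ∨ Var 1 ⊑ Var 0 ∘ One))
]%bt.

(* Main.v *)
Require Import Defs.
From Stdlib Require Import List Lia.
Import ListNotations.

(** Every bit string [u] is named by a closed term [lit u], and the proof is an
    induction on Sigma-formulas in which every free variable is replaced by
    such a name: if [a] holds in the standard structure under [r], then [B]
    proves [a] with [lit (r n)] put for the variable [n] ([Sigma_completeness]).
    A sentence is not changed by this substitution.

    The atomic cases require [B] to compute. It evaluates terms
    ([eval_provable]), because associativity and the unit laws give
    [lit_app]; it tells distinct strings apart ([lit_neq]), by comparing last
    bits; and it decides the substring relation ([sub_lit], [nsub_lit]).

    Connectives and existential quantifiers, bounded or not, are then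
    immediate: a witness is a string [d], and [lit d] names it. The bounded
    universal quantifier is the only case with real content, since models of
    [B] may contain elements that are not named. There [B] has to prove that
    anything below [lit v] is equal to the name of one of the finitely many
    substrings of [v] ([sub_lit_E]). The last axioms of [B] provide this: they
    reduce being a substring of [a y b], for bits [a] and [b], to equality or
    to being a substring of the shorter [a y] or [y b]; the same recursion
    describes the true substring relation ([substring_ends]), and it is what
    the induction [ends_ind] follows. *)

(** * Substitution *)

Definition scons (t : term) (f : nat -> term) (n : nat) : term :=
  match n with
  | 0 => t
  | S m => f m
  end.

Lemma tsubst_ext t f g :
  (forall k, occurs k t -> f k = g k) -> tsubst f t = tsubst g t.
Proof.
  induction t; cbn; intros H; auto.
  rewrite IHt1, IHt2; auto.
Qed.

Lemma fsubst_ext a : forall f g,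
  (forall k, free k a -> f k = g k) -> fsubst f a = fsubst g a.
Proof.
  assert (Hup : forall a f g, (forall k, free (S k) a -> f k = g k) ->
            forall k, free k a -> up f k = up g k).
  { intros b f g H [|k] Hk; cbn; [reflexivity|]. now rewrite H. }
  induction a; cbn; intros f g H; f_equal; auto;
    solve [apply tsubst_ext; auto | apply IHa, Hup; auto].
Qed.

Lemma tsubst_comp f g t :
  tsubst f (tsubst g t) = tsubst (fun n => tsubst f (g n)) t.
Proof. induction t; cbn; congruence. Qed.

Lemma tsubst_up_tshift f t : tsubst (up f) (tshift t) = tshift (tsubst f t).
Proof. unfold tshift. now rewrite !tsubst_comp. Qed.

Lemma fsubst_comp a : forall f g,
  fsubst f (fsubst g a) = fsubst (fun n => tsubst f (g n)) a.
Proof.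
  induction a; cbn; intros f g; f_equal; auto using tsubst_comp;
    rewrite IHa; apply fsubst_ext; intros [|k] _; cbn; auto;
    apply tsubst_up_tshift.
Qed.

Lemma tsubst_Var t : tsubst Var t = t.
Proof. induction t; cbn; congruence. Qed.

Lemma fsubst_Var a : fsubst Var a = a.
Proof.
  induction a; cbn; f_equal; auto using tsubst_Var;
    rewrite <- IHa at 2; apply fsubst_ext; intros [|k] _; reflexivity.
Qed.

Lemma fsubst_sentence f a : sentence a -> fsubst f a = a.
Proof.
  intros H. rewrite <- (fsubst_Var a) at 2.
  apply fsubst_ext. intros k Hk. now destruct (H k).
Qed.

Lemma tsubst_single_tshift t s : tsubst (single t) (tshift s) = s.
Proof.
  unfold tshift. rewrite tsubst_comp.
  exact (tsubst_Var s).
Qed.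

Lemma inst_fsubst_up t f a : inst t (fsubst (up f) a) = fsubst (scons t f) a.
Proof.
  unfold inst. rewrite fsubst_comp. apply fsubst_ext.
  intros [|k] _; cbn; [reflexivity|]. apply tsubst_single_tshift.
Qed.

(** * Derived rules *)

Lemma weaken G a : derives G a -> forall G', incl G G' -> derives G' a.
Proof.
  assert (Hcons : forall (b : form) H H', incl H H' -> incl (b :: H) (b :: H')).
  { intros b H H' Hi. apply incl_cons; [now left|]. now apply incl_tl. }
  induction 1; intros G' HG'.
  - apply Hyp; auto.
  - apply Neg_I with b; auto.
  - apply Neg_Neg_E; auto.
  - apply And_I; auto.
  - apply And_E1 with b; auto.
  - apply And_E2 with a; auto.
  - apply Or_I1; auto.
  - apply Or_I2; auto.
  - apply Or_E with a b; auto.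
  - apply Imp_I; auto.
  - apply Imp_E with a; auto.
  - apply All_I; auto using incl_map.
  - apply All_E; auto.
  - apply Ex_I with t; auto.
  - apply Ex_E with a; auto using incl_map.
  - apply Eq_I.
  - apply Eq_E with s; auto.
Qed.

Lemma weaken_cons G a b : derives G a -> derives (b :: G) a.
Proof. intros H. apply (weaken G a H). now apply incl_tl, incl_refl. Qed.

Lemma Neg_E G a c : derives G a -> derives G (Neg a) -> derives G c.
Proof.
  intros H H'. apply Neg_Neg_E, Neg_I with a; now apply weaken_cons.
Qed.

(** Since instances are expressed by a simultaneous substitution, the rule can
    be repeated to instantiate a block of universal quantifiers, without any
    computation with nested shifts. *)
Lemma All_E_scons G f a t :
  derives G (fsubst f (All a)) -> derives G (fsubst (scons t f) a).
Proof.
  intros H. rewrite <- inst_fsubst_up. now apply All_E.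
Qed.

(** Leibniz' law for two terms at once. The remaining variables of the pattern
    [a] are filled by [f], so that symmetry, transitivity, the congruences and
    the rewriting of both sides of an axiom are all instances in which the
    substitutions compute. *)
Lemma eq_subst2 G f a s s' t t' :
  derives G (Eq s s') -> derives G (Eq t t') ->
  derives G (fsubst (scons s (scons t f)) a) ->
  derives G (fsubst (scons s' (scons t' f)) a).
Proof.
  intros Hs Ht H.
  set (second := fun n => match n with
                          | 0 => tshift s'
                          | 1 => Var 0
                          | S (S m) => tshift (f m)
                          end).
  assert (E : forall u,
            inst u (fsubst second a) = fsubst (scons s' (scons u f)) a).
  { intros u. unfold inst. rewrite fsubst_comp. apply fsubst_ext.
    intros [|[|k]] _; cbn; auto using tsubst_single_tshift. }
  rewrite <- E. apply Eq_E with t; [assumption|]. rewrite E.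
  rewrite <- inst_fsubst_up in *. now apply Eq_E with s.
Qed.

Lemma eq_sym G s t : derives G (Eq s t) -> derives G (Eq t s).
Proof.
  intros H.
  exact (eq_subst2 G Var (Eq (Var 0) (Var 1)) s t s s H (Eq_I G s) (Eq_I G s)).
Qed.

Lemma eq_trans G s t u :
  derives G (Eq s t) -> derives G (Eq t u) -> derives G (Eq s u).
Proof.
  intros H H'.
  exact (eq_subst2 G Var (Eq (Var 0) (Var 1)) s s t u (Eq_I G s) H' H).
Qed.

Lemma cat_cong G s s' t t' :
  derives G (Eq s s') -> derives G (Eq t t') ->
  derives G (Eq (Cat s t) (Cat s' t')).
Proof.
  intros Hs Ht.
  exact (eq_subst2 G (fun _ => Cat s t) (Eq (Var 2) (Cat (Var 0) (Var 1)))
           s s' t t' Hs Ht (Eq_I G (Cat s t))).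
Qed.

Lemma sub_cong G s s' t t' :
  derives G (Eq s s') -> derives G (Eq t t') ->
  derives G (Sub s t) -> derives G (Sub s' t').
Proof. exact (eq_subst2 G Var (Sub (Var 0) (Var 1)) s s' t t'). Qed.

Lemma nsub_cong G s s' t t' :
  derives G (Eq s s') -> derives G (Eq t t') ->
  derives G (Neg (Sub s t)) -> derives G (Neg (Sub s' t')).
Proof. exact (eq_subst2 G Var (Neg (Sub (Var 0) (Var 1))) s s' t t'). Qed.

Lemma neq_cong G s s' t t' :
  derives G (Eq s s') -> derives G (Eq t t') ->
  derives G (Neg (Eq s t)) -> derives G (Neg (Eq s' t')).
Proof. exact (eq_subst2 G Var (Neg (Eq (Var 0) (Var 1))) s s' t t'). Qed.

(** * The axioms at arbitrary terms *)

Definition bit (b : bool) : term := if b then One else Zero.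

Ltac axiom := apply Hyp; match goal with H : incl B _ |- _ => apply H end;
  cbn; tauto.

Lemma emp_cat G x : incl B G -> derives G (Eq (Cat Emp x) x).
Proof.
  intros HG. apply eq_sym. eapply And_E1.
  apply (All_E_scons G Var (And (Eq (Var 0) (Cat Emp (Var 0)))
                                (Eq (Var 0) (Cat (Var 0) Emp))) x).
  axiom.
Qed.

Lemma cat_emp G x : incl B G -> derives G (Eq (Cat x Emp) x).
Proof.
  intros HG. apply eq_sym. eapply And_E2.
  apply (All_E_scons G Var (And (Eq (Var 0) (Cat Emp (Var 0)))
                                (Eq (Var 0) (Cat (Var 0) Emp))) x).
  axiom.
Qed.

Lemma cat_assoc G x y z :
  incl B G -> derives G (Eq (Cat (Cat x y) z) (Cat x (Cat y z))).
Proof.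
  intros HG.
  apply (All_E_scons G (scons y (scons x Var))
           (Eq (Cat (Cat (Var 2) (Var 1)) (Var 0))
               (Cat (Var 2) (Cat (Var 1) (Var 0)))) z).
  do 2 apply All_E_scons. axiom.
Qed.

Lemma cat_bit_neq G b x y :
  incl B G -> derives G (Neg (Eq x y)) ->
  derives G (Neg (Eq (Cat x (bit b)) (Cat y (bit b)))).
Proof.
  intros HG H.
  assert (D : derives G (And (Neg (Eq (Cat x Zero) (Cat y Zero)))
                             (Neg (Eq (Cat x One) (Cat y One))))).
  { apply Imp_E with (2 := H).
    apply (All_E_scons G (scons x Var)
             (Imp (Neg (Eq (Var 1) (Var 0)))
                  (And (Neg (Eq (Cat (Var 1) Zero) (Cat (Var 0) Zero)))
                       (Neg (Eq (Cat (Var 1) One) (Cat (Var 0) One))))) y).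
    apply All_E_scons. axiom. }
  destruct b; [eapply And_E2 | eapply And_E1]; exact D.
Qed.

Lemma neq_sym G s t : derives G (Neg (Eq s t)) -> derives G (Neg (Eq t s)).
Proof.
  intros H. apply Neg_I with (Eq s t).
  - apply eq_sym. apply Hyp. now left.
  - now apply weaken_cons.
Qed.

Lemma last_bit_neq G b c x y :
  incl B G -> b <> c -> derives G (Neg (Eq (Cat x (bit b)) (Cat y (bit c)))).
Proof.
  intros HG Hbc.
  assert (D : forall u v, derives G (Neg (Eq (Cat u Zero) (Cat v One)))).
  { intros u v.
    apply (All_E_scons G (scons u Var)
             (Neg (Eq (Cat (Var 1) Zero) (Cat (Var 0) One))) v).
    apply All_E_scons. axiom. }
  destruct b, c; try now destruct Hbc.
  - apply neq_sym, D.
  - apply D.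
Qed.

(** If [e] were [x b], multiplying on the left by the other bit [c] would make
    [c = e c] equal to [(c x) b], against the distinctness of last bits. *)
Lemma emp_neq_cat_bit G b x :
  incl B G -> derives G (Neg (Eq Emp (Cat x (bit b)))).
Proof.
  intros HG. set (c := bit (negb b)).
  assert (HG' : incl B (Eq Emp (Cat x (bit b)) :: G)) by now apply incl_tl.
  apply Neg_I with (Eq (Cat Emp c) (Cat (Cat c x) (bit b))).
  - apply eq_trans with c; [now apply emp_cat|].
    apply eq_trans with (Cat c Emp); [now apply eq_sym, cat_emp|].
    apply eq_trans with (Cat c (Cat x (bit b))).
    + apply cat_cong; [apply Eq_I|]. apply Hyp. now left.
    + now apply eq_sym, cat_assoc.
  - apply last_bit_neq; [assumption|]. now destruct b.
Qed.

Lemma sub_emp_iff G x : incl B G -> derives G (Iff (Sub x Emp) (Eq x Emp)).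
Proof.
  intros HG.
  apply (All_E_scons G Var (Iff (Sub (Var 0) Emp) (Eq (Var 0) Emp)) x).
  axiom.
Qed.

Lemma sub_bit_iff G b x :
  incl B G -> derives G (Iff (Sub x (bit b)) (Or (Eq x Emp) (Eq x (bit b)))).
Proof.
  intros HG. destruct b.
  - apply (All_E_scons G Var (Iff (Sub (Var 0) One)
                                (Or (Eq (Var 0) Emp) (Eq (Var 0) One))) x).
    axiom.
  - apply (All_E_scons G Var (Iff (Sub (Var 0) Zero)
                                (Or (Eq (Var 0) Emp) (Eq (Var 0) Zero))) x).
    axiom.
Qed.

Lemma sub_bits_iff G b c x y :
  incl B G ->
  derives G (Iff (Sub x (Cat (Cat (bit b) y) (bit c)))
                 (Or (Eq x (Cat (Cat (bit b) y) (bit c)))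
                     (Or (Sub x (Cat (bit b) y)) (Sub x (Cat y (bit c)))))).
Proof.
  intros HG.
  assert (D : forall s t,
    let a := Iff (Sub (Var 1) (Cat (Cat s (Var 0)) t))
                 (Or (Eq (Var 1) (Cat (Cat s (Var 0)) t))
                     (Or (Sub (Var 1) (Cat s (Var 0)))
                         (Sub (Var 1) (Cat (Var 0) t)))) in
    In (All (All a)) B -> derives G (fsubst (scons y (scons x Var)) a)).
  { intros s t a Ha. do 2 apply All_E_scons.
    rewrite fsubst_Var. apply Hyp. auto. }
  destruct b, c; [apply (D One One) | apply (D One Zero)
    | apply (D Zero One) | apply (D Zero Zero)]; cbn; tauto.
Qed.

(** * Names of bit strings *)

Fixpoint lit (u : list bool) : term :=
  match u with
  | [] => Emp
  | b :: u => Cat (bit b) (lit u)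
  end.

Lemma tsubst_lit f u : tsubst f (lit u) = lit u.
Proof. induction u as [|[] u IH]; cbn; congruence. Qed.

Lemma lit_app G u v :
  incl B G -> derives G (Eq (lit (u ++ v)) (Cat (lit u) (lit v))).
Proof.
  intros HG. induction u as [|b u IH]; cbn.
  - now apply eq_sym, emp_cat.
  - eapply eq_trans; [apply cat_cong; [apply Eq_I | exact IH]|].
    now apply eq_sym, cat_assoc.
Qed.

Lemma lit_snoc G u b :
  incl B G -> derives G (Eq (Cat (lit u) (bit b)) (lit (u ++ [b]))).
Proof.
  intros HG. apply eq_sym. eapply eq_trans; [now apply lit_app|].
  apply cat_cong; [apply Eq_I|]. now apply cat_emp.
Qed.

Lemma eval_provable G (r : nat -> list bool) t :
  incl B G ->
  derives G (Eq (tsubst (fun n => lit (r n)) t) (lit (eval bitstrings r t))).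
Proof.
  intros HG. induction t; cbn; try apply Eq_I.
  - now apply eq_sym, (cat_emp G Zero).
  - now apply eq_sym, (cat_emp G One).
  - eapply eq_trans; [apply cat_cong; eassumption|].
    now apply eq_sym, lit_app.
Qed.

Lemma lit_neq G u v :
  incl B G -> u <> v -> derives G (Neg (Eq (lit u) (lit v))).
Proof.
  intros HG. revert v.
  induction u as [|b u IH] using rev_ind; intros v;
    destruct v as [|c v _] using rev_ind; intros Huv.
  - now destruct Huv.
  - eapply neq_cong; [apply Eq_I | now apply lit_snoc |].
    now apply emp_neq_cat_bit.
  - apply neq_sym. eapply neq_cong; [apply Eq_I | now apply lit_snoc |].
    now apply emp_neq_cat_bit.
  - eapply neq_cong; [now apply lit_snoc | now apply lit_snoc |].
    destruct (Bool.bool_dec b c) as [<-|Hbc].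
    + apply cat_bit_neq; [assumption|]. apply IH. congruence.
    + now apply last_bit_neq.
Qed.

(** * Substrings *)

(** The recursion on strings that the substring axioms of [B] follow. *)
Lemma ends_ind (P : list bool -> Prop) :
  P [] -> (forall b, P [b]) ->
  (forall b y c, P (b :: y) -> P (y ++ [c]) -> P (b :: y ++ [c])) ->
  forall v, P v.
Proof.
  intros H0 H1 H2.
  assert (H : forall n v, length v <= n -> P v).
  { induction n as [|n IH]; intros [|b v] Hv; auto; [cbn in Hv; lia|].
    destruct v as [|c y _] using rev_ind; auto.
    cbn in Hv. rewrite length_app in Hv. cbn in Hv.
    apply H2; apply IH; rewrite ?length_app; cbn; lia. }
  intros v. now apply (H (length v)).
Qed.

Lemma substring_nil u : substring u [] <-> u = [].
Proof.
  split.
  - intros (x & y & E). apply app_eq_nil in E as [_ E].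
    now apply app_eq_nil in E as [E _].
  - intros ->. now exists [], [].
Qed.

(** A proper substring of [b y c] misses one of the two ends. *)
Lemma substring_ends u b y c :
  substring u (b :: y ++ [c]) <->
  u = b :: y ++ [c] \/ substring u (b :: y) \/ substring u (y ++ [c]).
Proof.
  split.
  - intros (p & q & E). destruct p as [|d p]; cbn in E.
    + destruct q as [|d q _] using rev_ind.
      * left. now rewrite app_nil_r in E.
      * right; left. exists [], q. cbn.
        rewrite app_assoc in E. change (b :: y ++ [c]) with ((b :: y) ++ [c]) in E.
        now apply app_inj_tail in E.
    + right; right. injection E as _ E. now exists p, q.
  - intros [-> | [(p & q & E) | (p & q & E)]].
    + exists [], []. now rewrite app_nil_r.
    + exists p, (q ++ [c]).
      change (b :: y ++ [c]) with ((b :: y) ++ [c]). rewrite <- E.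
      now rewrite !app_assoc.
    + exists (b :: p), q. cbn. now rewrite E.
Qed.

Lemma substring_single u b : substring u [b] <-> u = [] \/ u = [b].
Proof.
  split.
  - intros (p & q & E). destruct u as [|d u]; [now left|right].
    destruct p as [|d' p]; cbn in E; injection E as -> E.
    + apply app_eq_nil in E as [-> _]. reflexivity.
    + now destruct p.
  - intros [-> | ->]; [now exists [], [b] | now exists [], []].
Qed.

Lemma sub_lit_single_iff G b x :
  incl B G ->
  derives G (Iff (Sub x (lit [b])) (Or (Eq x Emp) (Eq x (lit [b])))).
Proof.
  intros HG.
  refine (eq_subst2 G (scons x Var)
    (Iff (Sub (Var 2) (Var 0)) (Or (Eq (Var 2) Emp) (Eq (Var 2) (Var 0))))
    _ (lit [b]) x x _ (Eq_I G x) (sub_bit_iff G b x HG)).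
  now apply eq_sym, cat_emp.
Qed.

Lemma sub_lit_ends_iff G b y c x :
  incl B G ->
  derives G (Iff (Sub x (lit (b :: y ++ [c])))
                 (Or (Eq x (lit (b :: y ++ [c])))
                     (Or (Sub x (lit (b :: y))) (Sub x (lit (y ++ [c])))))).
Proof.
  intros HG.
  refine (eq_subst2 G (scons x (scons (lit (b :: y)) Var))
    (Iff (Sub (Var 2) (Var 0))
         (Or (Eq (Var 2) (Var 0)) (Or (Sub (Var 2) (Var 3)) (Sub (Var 2) (Var 1)))))
    _ (lit (b :: y ++ [c])) _ (lit (y ++ [c]))
    _ (lit_snoc G y c HG) (sub_bits_iff G b c x (lit y) HG)).
  exact (lit_snoc G (b :: y) c HG).
Qed.

Lemma sub_lit G u v :
  incl B G -> substring u v -> derives G (Sub (lit u) (lit v)).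
Proof.
  intros HG. induction v as [|b|b y c IH1 IH2] using ends_ind; intros H.
  - apply substring_nil in H as ->.
    eapply Imp_E; [eapply And_E2, sub_emp_iff; assumption|]. apply Eq_I.
  - eapply Imp_E; [eapply And_E2, sub_lit_single_iff; assumption|].
    apply substring_single in H as [-> | ->]; [apply Or_I1 | apply Or_I2];
      apply Eq_I.
  - eapply Imp_E; [eapply And_E2, sub_lit_ends_iff; assumption|].
    apply substring_ends in H as [-> | [H | H]].
    + apply Or_I1, Eq_I.
    + apply Or_I2, Or_I1. auto.
    + apply Or_I2, Or_I2. auto.
Qed.

(** Elimination form of the provable finite disjunction that lists the
    substrings of [v]; the term [x] is arbitrary, in particular it may be an
    eigenvariable. *)
Lemma sub_lit_E v : forall G x c,
  incl B G -> derives G (Sub x (lit v)) ->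
  (forall w, substring w v -> derives G (Imp (Eq x (lit w)) c)) ->
  derives G c.
Proof.
  induction v as [|b|b y d IH1 IH2] using ends_ind; intros G x c HG Hx H.
  - apply (Imp_E G (Eq x (lit [])) c).
    + apply H. now apply substring_nil.
    + eapply Imp_E; [|exact Hx]. eapply And_E1. now apply sub_emp_iff.
  - eapply Or_E.
    + eapply Imp_E; [|exact Hx]. eapply And_E1. now apply sub_lit_single_iff.
    + apply Imp_E with (Eq x (lit [])); [|apply Hyp; now left].
      apply weaken_cons, H, substring_single. now left.
    + apply Imp_E with (Eq x (lit [b])); [|apply Hyp; now left].
      apply weaken_cons, H, substring_single. now right.
  - eapply Or_E.
    + eapply Imp_E; [|exact Hx]. eapply And_E1. now apply sub_lit_ends_iff.
    + apply Imp_E with (Eq x (lit (b :: y ++ [d]))); [|apply Hyp; now left].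
      apply weaken_cons, H, substring_ends. now left.
    + eapply Or_E; [apply Hyp; now left | |].
      * apply IH1 with x; [now do 2 apply incl_tl | apply Hyp; now left |].
        intros w Hw. do 2 apply weaken_cons.
        apply H, substring_ends. tauto.
      * apply IH2 with x; [now do 2 apply incl_tl | apply Hyp; now left |].
        intros w Hw. do 2 apply weaken_cons.
        apply H, substring_ends. tauto.
Qed.

(** Were [lit u] below [lit v], it would equal the name of a substring [w] of
    [v]; but [u] is none of these, so each such equation is refutable. *)
Lemma nsub_lit G u v :
  incl B G -> ~ substring u v -> derives G (Neg (Sub (lit u) (lit v))).
Proof.
  intros HG H.
  assert (D : forall c, derives (Sub (lit u) (lit v) :: G) c).
  { intros c. apply (sub_lit_E v) with (lit u);
      [now apply incl_tl | apply Hyp; now left |].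
    intros w Hw. apply Imp_I. apply Neg_E with (Eq (lit u) (lit w)).
    - apply Hyp. now left.
    - apply lit_neq; [now do 2 apply incl_tl|]. intros ->. contradiction. }
  apply Neg_I with (Eq Emp Emp); apply D.
Qed.

(** * Completeness for Sigma-formulas *)

Lemma eval_tshift M d r t : eval M (extend M d r) (tshift t) = eval M r t.
Proof. unfold tshift. induction t; cbn; congruence. Qed.

Lemma fsubst_lit_extend d (r : nat -> list bool) a :
  inst (lit d) (fsubst (up (fun n => lit (r n))) a) =
  fsubst (fun n => lit (extend bitstrings d r n)) a.
Proof.
  rewrite inst_fsubst_up. apply fsubst_ext. now intros [|k] _.
Qed.

Lemma Ex_I_lit G d (r : nat -> list bool) a :
  derives G (fsubst (fun n => lit (extend bitstrings d r n)) a) ->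
  derives G (fsubst (fun n => lit (r n)) (Ex a)).
Proof.
  intros H. apply Ex_I with (lit d). now rewrite fsubst_lit_extend.
Qed.

(** Read from right to left, this exhibits a formula about the eigenvariable as
    an instance of itself, which is the form that the rule [Eq_E] needs in order
    to pass from [lit w] to the eigenvariable. *)
Lemma inst_Var0_lit (r : nat -> list bool) a :
  inst (Var 0) (fsubst (up (fun n => lit (r n))) a) =
  fsubst (up (fun n => lit (r n))) a.
Proof.
  rewrite inst_fsubst_up. apply fsubst_ext.
  intros [|k] _; cbn; [reflexivity|]. symmetry. apply tsubst_lit.
Qed.

(** A term filled with names is closed, so the bound of a quantifier is
    unaffected by passing under that quantifier. *)
Lemma tshift_lit_instance (r : nat -> list bool) t :
  tshift (tsubst (fun n => lit (r n)) t) = tsubst (fun n => lit (r n)) t.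
Proof.
  unfold tshift. rewrite tsubst_comp. apply tsubst_ext.
  intros k _. apply tsubst_lit.
Qed.

Lemma Sigma_completeness a : Sigma a -> forall r : nat -> list bool,
  sat bitstrings r a -> derives B (fsubst (fun n => lit (r n)) a).
Proof.
  pose proof (incl_refl B) as HB.
  assert (Hsub : forall s t (r : nat -> list bool), sat bitstrings r (Sub s t) ->
            derives B (fsubst (fun n => lit (r n)) (Sub s t))).
  { intros s t r H. eapply sub_cong;
      [now apply eq_sym, eval_provable | now apply eq_sym, eval_provable |].
    now apply sub_lit. }
  induction 1 as [s t|s t|s t|s t|a b _ IHa _ IHb|a b _ IHa _ IHb
                 |t a _ IH|t a _ IH|a _ IH]; intros r H.
  - now apply Hsub.
  - eapply nsub_cong;
      [now apply eq_sym, eval_provable | now apply eq_sym, eval_provable |].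
    now apply nsub_lit.
  - cbn in *. eapply eq_trans; [now apply eval_provable|].
    rewrite H. now apply eq_sym, eval_provable.
  - eapply neq_cong;
      [now apply eq_sym, eval_provable | now apply eq_sym, eval_provable |].
    now apply lit_neq.
  - destruct H as [H | H]; [apply Or_I1 | apply Or_I2]; auto.
  - destruct H. apply And_I; auto.
  - destruct H as (d & H1 & H2). apply Ex_I_lit with d.
    apply And_I; [now apply Hsub | now apply IH].
  - unfold BAll. cbn [fsubst tsubst up].
    rewrite tsubst_up_tshift, tshift_lit_instance.
    (* All axioms are sentences, so the eigenvariable condition leaves [B] as
       it is. *)
    apply All_I. change (map fshift B) with B. apply Imp_I.
    set (G := _ :: B).
    assert (HG : incl B G) by now apply incl_tl.
    apply (sub_lit_E (eval bitstrings r t)) with (Var 0); [assumption | |].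
    + eapply sub_cong; [apply Eq_I | now apply eval_provable |].
      apply Hyp. now left.
    + intros w Hw. apply Imp_I. rewrite <- inst_Var0_lit.
      apply Eq_E with (lit w); [apply eq_sym, Hyp; now left|].
      rewrite fsubst_lit_extend. do 2 apply weaken_cons.
      apply IH. apply H. cbn. now rewrite eval_tshift.
  - destruct H as (d & H). apply Ex_I_lit with d.
    now apply IH.
Qed.

Theorem theorem2 (phi : form) (hSigma : Sigma phi) (hsent : sentence phi) :
  models bitstrings phi -> derives B phi.
Proof.
  intros H.
  rewrite <- (fsubst_sentence (fun _ => lit []) phi hsent).
  exact (Sigma_completeness phi hSigma (fun _ => []) (H _)).
Qed.
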